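(* Let $L$ be a completely distributive lattice, let $L^{L}$ be the complete lattice of all order-preserving maps $L\to L$ with the pointwise order, and for $f,g\in L^{L}$ define $(g\cdot f)(a)=\bigvee\{c\in L\mid \exists b\in L:\ b\triangleleft f(a)\text{ and } c\triangleleft g(b)\}$ for all $a\in L$, where $\triangleleft$ is the wedge-below relation. Then $(L^{L},\cdot)$ is a quantale.
   Context: In a complete lattice $P$, $x$ is wedge-below $y$, written $x\triangleleft y$, if for every subset $A\subseteq P$ (possibly empty) with $y\leq\bigvee A$ there is $a\in A$ with $x\leq a$. A complete lattice $L$ is completely distributive if $x=\bigvee\{y\in L\mid y\triangleleft x\}$ for all $x\in L$. A quantale is a complete lattice $Q$ with an associative binary operation $\ast$ such that $a\ast(\bigvee_{i\in I}b_i)=\bigvee_{i\in I}(a\ast b_i)$ and $(\bigvee_{i\in I}b_i)\ast a=\bigvee_{i\in I}(b_i\ast a)$ for all $a\in Q$ and all families $\{b_i\}_{i\in I}\subseteq Q$ (including the empty family). *)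

(* Defs.v *)
From HB Require Import structures.
From mathcomp Require Import all_boot all_order.
From mathcomp Require Import boolp classical_sets.
Set Implicit Arguments.
Unset Strict Implicit.
Unset Printing Implicit Defensive.
Import Order.TTheory.
Local Open Scope order_scope.
Local Open Scope classical_set_scope.

HB.mixin Record POrder_isComplete d T of Order.POrder d T := {
  bigjoin : set T -> T;
  bigmeet : set T -> T;
  bigjoin_supremum : forall A, supremums A (bigjoin A);
  bigmeet_infimum : forall A, infimums A (bigmeet A);
}.

#[short(type="completeLatticeType")]
HB.structure Definition CompleteLattice d :=
  { T of Order.POrder d T & POrder_isComplete d T }.

Section BigJoinTheory.
Context (d : Order.disp_t) (L : completeLatticeType d).
Implicit Types (A : set L) (x : L).

Lemma bigjoin_ub A x : A x -> x <= bigjoin A.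
Proof. by have [ubA _] := bigjoin_supremum A; exact: ubA. Qed.

Lemma bigjoin_le A x : ubound A x -> bigjoin A <= x.
Proof. by have [_ lubA] := bigjoin_supremum A; exact: lubA. Qed.

Lemma bigmeet_lb A x : A x -> bigmeet A <= x.
Proof. by have [lbA _] := bigmeet_infimum A; exact: lbA. Qed.

Lemma bigmeet_ge A x : lbound A x -> x <= bigmeet A.
Proof. by have [_ glbA] := bigmeet_infimum A; exact: glbA. Qed.

Lemma le_bigjoin (A B : set L) : A `<=` B -> bigjoin A <= bigjoin B.
Proof. by move=> AB; apply: bigjoin_le => x /AB; exact: bigjoin_ub. Qed.

End BigJoinTheory.

Definition wedge_below d (L : completeLatticeType d) (x y : L) : Prop :=
  forall A : set L, y <= bigjoin A -> exists2 a, A a & x <= a.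

Definition completely_distributive d (L : completeLatticeType d) : Prop :=
  forall x : L, x = bigjoin [set y | wedge_below y x].

Definition is_quantale d (Q : completeLatticeType d) (op : Q -> Q -> Q) : Prop :=
  [/\ associative op,
      forall (a : Q) (I : Type) (b : I -> Q),
        op a (bigjoin (range b)) = bigjoin (range (fun i => op a (b i)))
    & forall (a : Q) (I : Type) (b : I -> Q),
        op (bigjoin (range b)) a = bigjoin (range (fun i => op (b i) a))].

Section MonotoneMaps.
Context d (T : porderType d) d' (L : completeLatticeType d').
Implicit Types (f g : {omorphism T -> L}) (F : set {omorphism T -> L}).

HB.instance Definition _ := gen_eqMixin {omorphism T -> L}.
HB.instance Definition _ := gen_choiceMixin {omorphism T -> L}.

Lemma omorphism_eq f g : (f : T -> L) = g -> f = g.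
Proof.
case: f g => [f [[fm]]] [g [[gm]]] /= fg; case: _ / fg in gm *.
by rewrite (Prop_irrelevance fm gm).
Qed.

Definition omorphism_le f g : bool := ((f : T -> L) <= (g : T -> L)).

Lemma omorphism_le_refl : reflexive omorphism_le.
Proof. by move=> f; exact: lexx. Qed.

Lemma omorphism_le_anti : antisymmetric omorphism_le.
Proof. by move=> f g /le_anti /omorphism_eq. Qed.

Lemma omorphism_le_trans : transitive omorphism_le.
Proof. by move=> f g h; exact: le_trans. Qed.

HB.instance Definition _ :=
  Order.Le_isPOrder.Build FunOrder.fun_display {omorphism T -> L}
    omorphism_le_refl omorphism_le_anti omorphism_le_trans.

Lemma omorphism_leP f g : reflect (forall x, f x <= g x) (f <= g).
Proof. exact: lefP. Qed.

Definition ptjoin F (x : T) : L := bigjoin [set f x | f in F].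
Definition ptmeet F (x : T) : L := bigmeet [set f x | f in F].

Lemma ptjoin_homo F : {homo ptjoin F : x y / x <= y}.
Proof.
move=> x y xy; apply: bigjoin_le => _ [f Ff <-].
by apply: (le_trans (omorph_le f xy)); apply: bigjoin_ub; exists f.
Qed.

Lemma ptmeet_homo F : {homo ptmeet F : x y / x <= y}.
Proof.
move=> x y xy; apply: bigmeet_ge => _ [f Ff <-].
by apply: (le_trans _ (omorph_le f xy)); apply: bigmeet_lb; exists f.
Qed.

HB.instance Definition _ F :=
  Order.isOrderMorphism.Build _ T _ L (ptjoin F) (@ptjoin_homo F).
HB.instance Definition _ F :=
  Order.isOrderMorphism.Build _ T _ L (ptmeet F) (@ptmeet_homo F).

Definition omorphism_bigjoin F : {omorphism T -> L} := ptjoin F.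
Definition omorphism_bigmeet F : {omorphism T -> L} := ptmeet F.

Lemma omorphism_bigjoin_supremum F : supremums F (omorphism_bigjoin F).
Proof.
split=> [f Ff|g gF]; apply/omorphism_leP => x.
  by apply: bigjoin_ub; exists f.
by apply: bigjoin_le => _ [f Ff <-]; exact/omorphism_leP/gF.
Qed.

Lemma omorphism_bigmeet_infimum F : infimums F (omorphism_bigmeet F).
Proof.
split=> [f Ff|g gF]; apply/omorphism_leP => x.
  by apply: bigmeet_lb; exists f.
by apply: bigmeet_ge => _ [f Ff <-]; exact/omorphism_leP/gF.
Qed.

HB.instance Definition _ :=
  POrder_isComplete.Build FunOrder.fun_display {omorphism T -> L}
    omorphism_bigjoin_supremum omorphism_bigmeet_infimum.

End MonotoneMaps.

Section WedgeComposition.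
Context d (L : completeLatticeType d).
Implicit Types (f g : {omorphism L -> L}).

Definition wedge_comp_fun g f (a : L) : L :=
  bigjoin [set c | exists b, wedge_below b (f a) /\ wedge_below c (g b)].

Lemma wedge_comp_homo g f : {homo wedge_comp_fun g f : x y / x <= y}.
Proof.
move=> x y xy; apply: le_bigjoin => c [b [bfx cgb]]; exists b; split=> // A fyA.
by apply: bfx; exact: le_trans (omorph_le f xy) fyA.
Qed.

HB.instance Definition _ g f :=
  Order.isOrderMorphism.Build _ L _ L (wedge_comp_fun g f)
    (@wedge_comp_homo g f).

Definition wedge_comp g f : {omorphism L -> L} := wedge_comp_fun g f.

End WedgeComposition.

(* Main.v *)
(** In a completely distributive lattice an element is determined by the set of
    elements wedge-below it, and wedge-below is interpolative: [c] is wedge-below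
    [bigjoin A] iff it is wedge-below some element of [A]. Sending [f] to the
    relation [c] wedge-below [f a] therefore turns the composition into the
    composition of relations and joins into unions, and relational composition is
    associative and distributes over unions. *)

Require Import Defs.
From mathcomp Require Import all_boot all_order.
From mathcomp Require Import boolp classical_sets.
Import Order.TTheory.
Local Open Scope order_scope.
Local Open Scope classical_set_scope.

Section WedgeBelow.
Context {d : Order.disp_t} {L : completeLatticeType d}.
Implicit Types (x y z : L) (A : set L).

Lemma wedge_below_le_trans x y z :
  wedge_below x y -> y <= z -> wedge_below x z.
Proof. by move=> xy yz A zA; apply: xy; exact: le_trans zA. Qed.

Lemma le_wedge_below_trans x y z :
  x <= y -> wedge_below y z -> wedge_below x z.
Proof. by move=> xy yz A /yz[a Aa ya]; exists a => //; exact: le_trans ya. Qed.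

Hypothesis hL : completely_distributive L.

Lemma wedge_below_ext x y :
  (forall c, wedge_below c x <-> wedge_below c y) -> x = y.
Proof.
move=> xy; rewrite (hL x) (hL y); congr bigjoin.
by apply/seteqP; split=> c /xy.
Qed.

Lemma wedge_below_bigjoin A x :
  wedge_below x (bigjoin A) <-> exists2 a, A a & wedge_below x a.
Proof.
split=> [xA|[a Aa xa]]; last by apply: wedge_below_le_trans xa (bigjoin_ub Aa).
(* The hypothesis on [x] is tested not on [A] but on the elements wedge-below members of [A]. Their
   join still dominates each [a] in [A], since [a] is the join of the elements wedge-below it. *)
have /xA[y [a Aa ya] xy] :
    bigjoin A <= bigjoin [set y | exists2 a, A a & wedge_below y a].
  apply: bigjoin_le => a Aa; rewrite (hL a).
  by apply: le_bigjoin => y ya; exists a.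
by exists a => //; exact: le_wedge_below_trans ya.
Qed.

(** This is the previous lemma with [z] written as the join of the elements wedge-below it. *)
Lemma wedge_below_interpolate x z :
  wedge_below x z <-> exists2 y, wedge_below y z & wedge_below x y.
Proof. by rewrite {1}(hL z); exact: wedge_below_bigjoin. Qed.

Lemma wedge_below_omorphism_bigjoin {d' : Order.disp_t} {T : porderType d'}
    (F : set {omorphism T -> L}) (t : T) x :
  wedge_below x (bigjoin F t) <-> exists2 f, F f & wedge_below x (f t).
Proof.
(* Joins of monotone maps are pointwise by construction, so [bigjoin F t] converts to the join of
   the values at [t]. *)
split=> [/wedge_below_bigjoin[_ [f Ff <-]]|[f Ff xf]]; first by exists f.
by apply/wedge_below_bigjoin; exists (f t) => //; exists f.
Qed.

(** The join defining [wedge_comp] puts an extra wedge-below step after [g b]; interpolation absorbs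
    it. *)
Lemma wedge_below_comp (g f : {omorphism L -> L}) x c :
  wedge_below c (wedge_comp g f x) <->
  exists2 b, wedge_below b (f x) & wedge_below c (g b).
Proof.
split=> [/wedge_below_bigjoin[e [b [bf eg]] ce]|[b bf]].
  by exists b => //; apply/wedge_below_interpolate; exists e.
move=> /wedge_below_interpolate[e eg ce].
by apply/wedge_below_bigjoin; exists e => //; exists b.
Qed.

Lemma omorphism_wedge_ext {d' : Order.disp_t} {T : porderType d'}
    (f g : {omorphism T -> L}) :
  (forall t c, wedge_below c (f t) <-> wedge_below c (g t)) -> f = g.
Proof.
by move=> fg; apply/omorphism_eq/funext => t; exact: wedge_below_ext.
Qed.

End WedgeBelow.

Theorem theorem3p8 (d : Order.disp_t) (L : completeLatticeType d)
    (hL : completely_distributive L) :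
  is_quantale (@wedge_comp d L).
Proof.
(* For associativity both sides say that [e] is wedge-below [f x], [b] below [g e] and [c] below
   [h b]. For joins, the index commutes with the intermediate [b]; an empty family is covered, as
   nothing is wedge-below the empty join. *)
split=> [h g f|g I f|f I g]; apply: (omorphism_wedge_ext hL) => x c; split.
- move=> /(wedge_below_comp hL)[b /(wedge_below_comp hL)[e ef bg] ch].
  apply/(wedge_below_comp hL); exists e => //.
  by apply/(wedge_below_comp hL); exists b.
- move=> /(wedge_below_comp hL)[e ef /(wedge_below_comp hL)[b bg ch]].
  apply/(wedge_below_comp hL); exists b => //.
  by apply/(wedge_below_comp hL); exists e.
- move=> /(wedge_below_comp hL)[b].
  move=> /(wedge_below_omorphism_bigjoin hL)[_ [i _ <-] bf cg].
  apply/(wedge_below_omorphism_bigjoin hL); exists (wedge_comp g (f i)).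
    by exists i.
  by apply/(wedge_below_comp hL); exists b.
- move=> /(wedge_below_omorphism_bigjoin hL)[_ [i _ <-]].
  move=> /(wedge_below_comp hL)[b bf cg].
  apply/(wedge_below_comp hL); exists b => //.
  by apply/(wedge_below_omorphism_bigjoin hL); exists (f i) => //; exists i.
- move=> /(wedge_below_comp hL)[b bf].
  move=> /(wedge_below_omorphism_bigjoin hL)[_ [i _ <-] cg].
  apply/(wedge_below_omorphism_bigjoin hL); exists (wedge_comp (g i) f).
    by exists i.
  by apply/(wedge_below_comp hL); exists b.
- move=> /(wedge_below_omorphism_bigjoin hL)[_ [i _ <-]].
  move=> /(wedge_below_comp hL)[b bf cg].
  apply/(wedge_below_comp hL); exists b => //.
  by apply/(wedge_below_omorphism_bigjoin hL); exists (g i) => //; exists i.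
Qed.
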